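(* For any $\varepsilon\in(0,1]$, there is an $O\left(\frac{1}{\varepsilon}\log\left(\frac{d}{\varepsilon}\right)\right)$-competitive algorithm for chasing positive bodies in $\ell_1$ such that at every time $t$ the maintained point satisfies $x^{t}\in K_{t}^{1+\varepsilon}=\left\{ x^{t}\in \mathbb{R}_{+}^{n}\ |\ C^{t}x^{t}\geq1,\ P^{t}x^{t}\leq1+\varepsilon\right\}$, where $d$ is the maximal number of nonzero coefficients in any covering constraint (i.e. the maximum row sparsity of any matrix $C^t$).
   Context: Chasing positive bodies in $\ell_1$: a sequence of bodies $K_{t}=\{x^{t}\in\mathbb{R}_{+}^{n}\mid C^{t}x^{t}\ge1,\ P^{t}x^{t}\le1\}$ is revealed online, where $C^{t}$ and $P^{t}$ are matrices with nonnegative entries. Starting from $x^0=0$, the algorithm must (approximately) maintain a point $x^t\in K_t$ at each time $t$, and the goal is to minimize the total weighted $\ell_1$-movement $\sum_{t}\sum_{i=1}^{n}w_{i}|x_{i}^{t}-x_{i}^{t-1}|$ for a given weight vector $w\in\mathbb{R}_{+}^{n}$. Competitiveness is measured against the optimal offline solution that maintains a point in $K_t$ (with no packing violation) for all $t$; the algorithm is allowed $\varepsilon$-resource augmentation on the packing constraints. *)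

(* Defs.v *)
From HB Require Import structures.
From mathcomp Require Import all_boot all_order all_algebra.
From mathcomp Require Import all_classical all_reals all_analysis.

Set Implicit Arguments.
Unset Strict Implicit.
Unset Printing Implicit Defensive.

Import Order.TTheory GRing.Theory Num.Theory.

Local Open Scope classical_set_scope.
Local Open Scope ring_scope.

(* The data (C^t, P^t) revealed at one time step; the numbers of rows may
   change from one step to the next, and may be zero. *)
Record positive_body (R : realType) (n : nat) := PositiveBody {
  cover_rows : nat;
  pack_rows : nat;
  cover_mx : 'M[R]_(cover_rows, n);
  pack_mx : 'M[R]_(pack_rows, n);
  cover_mx_ge0 : forall i j, 0 <= cover_mx i j;
  pack_mx_ge0 : forall i j, 0 <= pack_mx i j
}.

(* The set {x >= 0 | C x >= 1, P x <= rho}: K_t itself is the case rho = 1,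
   and K_t^{1+eps} the case rho = 1 + eps. *)
Definition body_set (R : realType) (n : nat) (rho : R)
    (K : positive_body R n) : set 'cV[R]_n :=
  [set x : 'cV[R]_n | [/\ forall i, 0 <= x i 0,
               forall i, 1 <= (cover_mx K *m x) i 0
             & forall i, (pack_mx K *m x) i 0 <= rho]].

(* An input is a sequence K : nat -> positive_body R n with a horizon T; the
   bodies are K 1, ..., K T, and K 0 plays no role because time 0 only carries
   the starting point x^0 = 0. *)

(* A deterministic online algorithm chooses x^t from K_1, ..., K_t only. *)
Definition online_algorithm (R : realType) (n : nat) :=
  seq (positive_body R n) -> 'cV[R]_n.

Definition trajectory (R : realType) (n : nat) (A : online_algorithm R n)
    (K : nat -> positive_body R n) (t : nat) : 'cV[R]_n :=
  if t is 0%N then 0 else A [seq K s | s <- iota 1 t].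

Definition movement (R : realType) (n : nat) (w : 'cV[R]_n) (T : nat)
    (x : nat -> 'cV[R]_n) : R :=
  \sum_(1 <= t < T.+1) \sum_(i < n) w i 0 * `|x t i 0 - x t.-1 i 0|.

Definition offline_solution (R : realType) (n : nat)
    (K : nat -> positive_body R n) (T : nat) : set (nat -> 'cV[R]_n) :=
  [set y : nat -> 'cV[R]_n | y 0%N = 0 /\
           forall t, (1 <= t <= T)%N -> body_set 1 (K t) (y t)].

(* [inf] is the genuine infimum here as soon as an offline solution exists,
   i.e. as soon as K_1, ..., K_T are nonempty. *)
Definition offline_opt (R : realType) (n : nat) (w : 'cV[R]_n)
    (K : nat -> positive_body R n) (T : nat) : R :=
  inf (movement w T @` offline_solution K T).

Definition cover_sparsity (R : realType) (n : nat)
    (K : nat -> positive_body R n) (T : nat) : nat :=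
  \max_(1 <= t < T.+1) \max_(i < cover_rows (K t))
    #|[pred j : 'I_n | cover_mx (K t) i j != 0%R]|.

(* Main.v *)
Require Import Defs.
From HB Require Import structures.
From mathcomp Require Import all_boot all_order all_algebra.
From mathcomp Require Import all_classical all_reals all_analysis.
From mathcomp Require Import ring lra.

Import Order.TTheory GRing.Theory Num.Theory.
Import numFieldNormedType.Exports.

Local Open Scope classical_set_scope.
Local Open Scope ring_scope.

(* Put m = eps/16 and b = 1 + eps/2.  The position x is compared with an offline
   point y through the potential
     sum_i w_i (b y_i ln ((x_i + y_i/m) / (x_i + s y_i)) + x_i),
   with a shift s of at most m/d; the shift s y_i scales with y_i, so no bound on
   the size of the coefficients is needed.

   If x violates a covering constraint c, increase x_i at rate
   (c_i x_i + m/d_c)/w_i on the support of c, where d_c is its size.  If x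
   violates a packing constraint p by more than eps, decrease x_i at rate
   p_i x_i/w_i.  For every feasible y, a short step of either kind lowers the
   potential by at least m times its weighted length.  Call a displacement cheap
   if it has this property for all feasible y and all admissible s.  Being cheap
   is transitive and closed, so over the cheap displacements from x into a
   compact box the potential for one fixed y attains a minimum, and the
   minimizer is feasible up to 1 + eps because otherwise a further step would
   improve on it.  This needs positive weights; the general case follows by
   letting weights w_i + 1/(k+1) tend to w_i.

   Moving y changes the potential by at most
   b (ln (1/(m s)) + 1) sum_i w_i |dy_i|, so summing over time bounds the movement
   of the algorithm.  The shift s only occurs in the analysis: the algorithm does
   not need to know d. *)

(* The norm only serves to make [drift] continuous on all of [R]; positions
   are nonnegative. *)
Definition drift {R : realType} (L s y x : R) : R :=
  y * (ln (`|x| + L * y) - ln (`|x| + s * y)).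

(** * Estimates for the potential of a single coordinate *)

Lemma ler_lnB (R : realType) (a b : R) :
  0 < a -> 0 < b -> ln a - ln b <= (a - b) / b.
Proof.
move=> a0 b0; rewrite -ln_div ?posrE//.
have -> : a / b = 1 + (a - b) / b by field; rewrite gt_eqF.
apply: le_ln1Dx; rewrite mulrBl divff ?gt_eqF//.
have := divr_gt0 a0 b0; lra.
Qed.

Lemma drift_ge0 (R : realType) (L s y x : R) :
  0 < s -> s <= L -> 0 <= y -> 0 <= drift L s y x.
Proof.
move=> s0 sL; rewrite le_eqVlt => /predU1P[<-|y0]; first by rewrite /drift mul0r.
rewrite /drift mulr_ge0 ?(ltW y0)// subr_ge0 ler_ln ?posrE ?lerD2l ?ler_pM2r//.
- by rewrite ltr_wpDl// mulr_gt0.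
- by rewrite ltr_wpDl// mulr_gt0// (lt_le_trans s0).
Qed.

Lemma drift_continuous (R : realType) (L s y : R) :
  0 < s -> s <= L -> 0 <= y -> continuous (drift L s y).
Proof.
move=> s0 sL y0 x; move: y0; rewrite le_eqVlt => /predU1P[<-|y0].
  have -> : drift L s 0 = cst 0 by apply/funext => z; rewrite /drift mul0r.
  exact: cvg_cst.
have lnc a : 0 < a -> ln (`|z| + a * y) @[z --> x] --> ln (`|x| + a * y).
  move=> a0; apply: (@cvg_comp _ _ _ (fun z => `|z| + a * y)); last first.
    by apply: continuous_ln; rewrite ltr_wpDl// mulr_gt0.
  by apply: cvgD; [exact: norm_continuous|exact: cvg_cst].
apply: cvgM; first exact: cvg_cst.
by apply: cvgB; apply: lnc => //; exact: lt_le_trans sL.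
Qed.

(** With [x] standing for its absolute value, the slope in [y] is a log ratio between 0 and
    [ln (L / s)] plus [L y / (x + L y) - s y / (x + s y)], which lies in [[0, 1]]. So raising [y]
    costs at most this slope, and lowering it costs nothing. *)
Lemma drift_lipschitz (R : realType) (L s y y' x : R) :
  0 < s -> s <= L -> 0 <= y -> 0 <= y' ->
  drift L s y x - drift L s y' x <= (ln (L / s) + 1) * `|y - y'|.
Proof.
move=> s0 sL y0 y'0; have L0 : 0 < L by exact: lt_le_trans sL.
have lnLs : 0 <= ln (L / s) by rewrite ln_ge0// ler_pdivlMr// mul1r.
have bd z : 0 < z -> ln (`|x| + L * z) - ln (`|x| + s * z) <= ln (L / s).
  move=> z0; have ? : 0 < `|x| + L * z by rewrite ltr_wpDl// mulr_gt0.
  have ? : 0 < `|x| + s * z by rewrite ltr_wpDl// mulr_gt0.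
  rewrite -ln_div ?posrE// ler_ln ?posrE ?divr_gt0// ler_pdivrMr//.
  rewrite mulrDr (mulrA _ s) divfK ?gt_eqF// lerD2r ler_peMl//.
  by rewrite ler_pdivlMr// mul1r.
move: y0; rewrite le_eqVlt => /predU1P[<-|y0].
  rewrite {1}/drift mul0r sub0r (le_trans (y := 0))//.
    by rewrite oppr_le0 drift_ge0.
  by rewrite mulr_ge0// addr_ge0.
move: y'0; rewrite le_eqVlt => /predU1P[<-|y'0].
  rewrite /drift mul0r !subr0 (gtr0_norm y0) mulrC ler_pM2r//.
  by rewrite (le_trans (bd _ y0))// lerDl.
have pos a z : 0 < a -> 0 < z -> 0 < `|x| + a * z.
  by move=> a0 z0; rewrite ltr_wpDl// mulr_gt0.
have [yy'|yy'] := leP y' y.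
  have h1 : y' * ((ln (`|x| + L * y) - ln (`|x| + L * y'))) <= y - y'.
    have := ler_lnB _ _ _ (pos L y L0 y0) (pos L y' L0 y'0).
    rewrite -(ler_pM2l y'0) => /le_trans; apply.
    have -> : y' * ((`|x| + L * y - (`|x| + L * y')) / (`|x| + L * y'))
       = (y - y') * ((L * y') / (`|x| + L * y')).
      by field; rewrite gt_eqF// pos.
    rewrite ler_piMr ?subr_ge0// ler_pdivrMr ?pos// mul1r lerDr//.
  have h2 : ln (`|x| + s * y') <= ln (`|x| + s * y).
    by rewrite ler_ln ?posrE ?pos// lerD2l ler_pM2l.
  have h3 := bd _ y0.
  rewrite ger0_norm ?subr_ge0// /drift.
  move: h2 h3; rewrite -(ler_pM2l y'0) -subr_ge0 => h2 h3.
  have := ler_wpM2l (_ : 0 <= y - y') h3; rewrite subr_ge0 => /(_ yy').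
  lra.
have q : ln (`|x| + L * y) - ln (`|x| + s * y) <=
    ln (`|x| + L * y') - ln (`|x| + s * y').
  rewrite -!ln_div ?posrE ?pos//.
  rewrite ler_ln ?posrE ?divr_gt0 ?pos// ler_pdivrMr ?pos//.
  rewrite mulrAC ler_pdivlMr ?pos//.
  have : 0 <= `|x| * ((L - s) * (y' - y)).
    by rewrite !mulr_ge0// subr_ge0// ltW.
  lra.
rewrite (le_trans (y := 0))//; last by rewrite mulr_ge0// addr_ge0.
rewrite subr_le0 /drift ler_pM ?(ltW y0)// ?(ltW yy')//.
rewrite subr_ge0 ler_ln ?posrE ?pos// lerD2l ler_pM2r//.
Qed.

(** Tangents bound both logarithms: the [L] term at the old point, where [y / (x + L y) <= 1 / L],
    and the [s] term at the new one. *)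
Lemma drift_increase (R : realType) (L s y x x1 : R) :
  0 < s -> s <= L -> 0 <= y -> 0 <= x -> x <= x1 ->
  drift L s y x1 - drift L s y x <= (x1 - x) / L - y * (x1 - x) / (x1 + s * y).
Proof.
move=> s0 sL y0 x0 xx1; have L0 : 0 < L by exact: lt_le_trans sL.
have x10 := le_trans x0 xx1.
move: y0; rewrite le_eqVlt => /predU1P[<-|y0].
  by rewrite /drift !mul0r !subr0 divr_ge0 ?subr_ge0// ltW.
rewrite /drift !ger0_norm//.
have pos a z : 0 < a -> 0 <= z -> 0 < z + a * y.
  by move=> a0 z0; rewrite ltr_wpDl// mulr_gt0.
have h1 := ler_lnB _ _ _ (pos L x1 L0 x10) (pos L x L0 x0).
have h2 := ler_lnB _ _ _ (pos s x s0 x0) (pos s x1 s0 x10).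
have h3 : y * ((x1 + L * y - (x + L * y)) / (x + L * y)) <= (x1 - x) / L.
  rewrite opprD addrACA subrr addr0 mulrCA ler_wpM2l ?subr_ge0//.
  by rewrite ler_pdivrMr ?pos// mulrDr mulKf ?gt_eqF// lerDr mulr_ge0//
    invr_ge0 ltW.
have h4 : y * ((x + s * y - (x1 + s * y)) / (x1 + s * y)) =
    - (y * (x1 - x) / (x1 + s * y)).
  by rewrite opprD addrACA subrr addr0 -mulrA -mulrN -mulNr opprB.
move: h1 h2; rewrite -(ler_pM2l y0) -[_ <= (_ - _) / (x1 + _)](ler_pM2l y0).
rewrite h4; lra.
Qed.

(** The [L] term can only fall; the [s] term is bounded by its tangent at the new point. *)
Lemma drift_decrease (R : realType) (L s y x x1 : R) :
  0 < s -> s <= L -> 0 <= y -> 0 <= x1 -> x1 <= x ->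
  drift L s y x1 - drift L s y x <= y * (x - x1) / (x1 + s * y).
Proof.
move=> s0 sL y0 x10 x1x; have L0 : 0 < L by exact: lt_le_trans sL.
have x0 := le_trans x10 x1x.
move: y0; rewrite le_eqVlt => /predU1P[<-|y0]; first by rewrite /drift !mul0r subr0.
rewrite /drift !ger0_norm//.
have pos a z : 0 < a -> 0 <= z -> 0 < z + a * y.
  by move=> a0 z0; rewrite ltr_wpDl// mulr_gt0.
have h1 : ln (x1 + L * y) <= ln (x + L * y).
  by rewrite ler_ln ?posrE ?pos// lerD2r.
have h2 := ler_lnB _ _ _ (pos s x s0 x0) (pos s x1 s0 x10).
move: h1 h2; rewrite opprD addrACA subrr addr0 -(ler_pM2l y0)
   -[_ <= _ / _](ler_pM2l y0) mulrA.
lra.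
Qed.

(** * Short covering and packing steps *)

(** A value [<= 0] says that the potential drops by at least [m] times the weighted length. *)
Definition change {R : realType} {n : nat} (b m s : R)
    (w y x x1 : 'I_n -> R) : R :=
  \sum_i w i * (b * (drift m^-1 s (y i) (x1 i) - drift m^-1 s (y i) (x i))
                + (x1 i - x i) + m * `|x1 i - x i|).

(** Since [s <= k], the rate of gain [y (c x + k) / (x + s y)] is at least [min (c y) 1]: treat
    [c y <= 1] and [c y > 1] separately. The factor [1 + m] pays for evaluating at the new point, as
    [c (x1 - x) <= m (c x + k)]. *)
Lemma cover_coordinate (R : realType) (b m s k c w tau x y x1 : R) :
  0 <= b -> 0 < m -> 0 < s -> s <= m^-1 -> s <= k -> 0 < c -> 0 < w ->
  0 <= tau -> tau * c / w <= m -> 0 <= x -> 0 <= y ->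
  x1 = x + tau * (c * x + k) / w ->
  w * (b * (drift m^-1 s y x1 - drift m^-1 s y x) + (x1 - x) + m * `|x1 - x|)
  <= tau * ((b * m + 1 + m) * (c * x + k) - b * (Num.min (c * y) 1 / (1 + m))).
Proof.
move=> b0 m0 s0 sm sk c0 w0 tau0 taum x0 y0 x1E.
have k0 : 0 < k by exact: lt_le_trans sk.
have cx0 : 0 <= c * x by rewrite mulr_ge0// ltW.
have cxk0 : 0 < c * x + k by rewrite ltr_wpDl.
have d0 : 0 <= x1 - x.
  by rewrite x1E addrAC subrr add0r divr_ge0 ?(ltW w0)// mulr_ge0// ltW.
have xx1 : x <= x1 by rewrite -subr_ge0.
rewrite (ger0_norm d0).
have wd : w * (x1 - x) = tau * (c * x + k).
  by rewrite x1E addrAC subrr add0r mulrC divfK// gt_eqF.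
have key : tau * (Num.min (c * y) 1 / (1 + m)) <=
    w * (y * (x1 - x) / (x1 + s * y)).
  move: y0; rewrite le_eqVlt => /predU1P[<-|y0].
    by rewrite !(mulr0, mul0r) minEle ler01 !(mul0r, mulr0).
  have X0 : 0 < x1 + s * y.
    by rewrite ltr_wpDl ?mulr_gt0// (le_trans x0).
  have -> : w * (y * (x1 - x) / (x1 + s * y)) =
      tau * (y * (c * x + k) / (x1 + s * y)).
    have -> : w * (y * (x1 - x) / (x1 + s * y)) =
       w * (x1 - x) * (y / (x1 + s * y)) by ring.
    by rewrite wd; ring.
  rewrite ler_wpM2l// ler_pdivlMr// mulrAC ler_pdivrMr ?addr_gt0//.
  rewrite -(ler_pM2l c0).
  have h : c * (x1 + s * y) <= c * x * (1 + m) + m * k + k * (c * y).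
    have h1 : c * (tau * (c * x + k) / w) <= m * (c * x + k).
      have -> : c * (tau * (c * x + k) / w) = tau * c / w * (c * x + k) by ring.
      by rewrite ler_pM2r.
    have h2 : s * (c * y) <= k * (c * y) by rewrite ler_pM2r// mulr_gt0.
    rewrite x1E; lra.
  have z0 : 0 < c * y by rewrite mulr_gt0.
  have -> : c * (Num.min (c * y) 1 * (x1 + s * y)) =
     Num.min (c * y) 1 * (c * (x1 + s * y)) by ring.
  have -> : c * (y * (c * x + k) * (1 + m)) = c * y * (c * x + k) * (1 + m).
    by ring.
  move: (c * y) (c * x) z0 cx0 h => z X z0 X0' h.
  have [z1|z1] := leP z 1.
    apply: le_trans (ler_wpM2l (ltW z0) h) _.
    by rewrite -mulrA ler_pM2l//; have := ler_wpM2l (ltW k0) z1; lra.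
  rewrite mul1r (le_trans h)//.
  have mk : 0 < m * k by rewrite mulr_gt0.
  have Xm : 0 <= X * (1 + m) by rewrite mulr_ge0// addr_ge0// ltW.
  have := ler_wpM2l (ltW mk) (ltW z1); have := ler_wpM2l Xm (ltW z1); lra.
have up := drift_increase _ _ _ _ _ _ s0 sm y0 x0 xx1.
rewrite invrK in up.
have := ler_wpM2l b0 (ler_wpM2l (ltW w0) up).
have := ler_wpM2l b0 key.
have -> : b * (w * ((x1 - x) * m - y * (x1 - x) / (x1 + s * y))) =
  b * m * (w * (x1 - x)) - b * (w * (y * (x1 - x) / (x1 + s * y))) by ring.
have -> : w * (b * (drift m^-1 s y x1 - drift m^-1 s y x) + (x1 - x) +
   m * (x1 - x)) = b * (w * (drift m^-1 s y x1 - drift m^-1 s y x)) +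
   (1 + m) * (w * (x1 - x)) by ring.
rewrite wd; lra.
Qed.

(** One step removes at most a fraction [m] of [x], so [x / (x1 + s y) <= 1 / (1 - m)]. *)
Lemma pack_coordinate (R : realType) (b m s p w tau x y x1 : R) :
  0 <= b -> 0 < m -> m < 1 -> 0 < s -> s <= m^-1 -> 0 <= p -> 0 < w ->
  0 <= tau -> tau * p / w <= m -> 0 <= x -> 0 <= y ->
  x1 = x - x * (tau * p / w) ->
  w * (b * (drift m^-1 s y x1 - drift m^-1 s y x) + (x1 - x) + m * `|x1 - x|)
  <= tau * (b * (p * y / (1 - m)) - (1 - m) * (p * x)).
Proof.
move=> b0 m0 m1 s0 sm p0 w0 tau0 taum x0 y0 x1E.
have v0 : 0 <= tau * p / w by rewrite divr_ge0 ?(ltW w0)// mulr_ge0.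
have dE : x1 - x = - (x * (tau * p / w)) by rewrite x1E; ring.
have d0 : x1 - x <= 0 by rewrite dE oppr_le0 mulr_ge0.
have x1x : x1 <= x by rewrite -subr_le0.
rewrite (ler0_norm d0).
have wd : w * (x1 - x) = - (tau * (p * x)) by rewrite dE; field; rewrite gt_eqF.
have x1m : x * (1 - m) <= x1 by rewrite x1E; have := ler_wpM2l x0 taum; lra.
have x10 : 0 <= x1 by rewrite (le_trans _ x1m)// mulr_ge0// subr_ge0 ltW.
have key : w * (y * (x - x1) / (x1 + s * y)) <= tau * (p * y / (1 - m)).
  move: y0; rewrite le_eqVlt => /predU1P[<-|y0]; first by rewrite !(mulr0, mul0r).
  have X0 : 0 < x1 + s * y by rewrite ltr_wpDl ?mulr_gt0.
  have -> : w * (y * (x - x1) / (x1 + s * y)) =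
      tau * p * y * (x / (x1 + s * y)).
    have -> : w * (y * (x - x1) / (x1 + s * y)) =
       - (w * (x1 - x)) * (y / (x1 + s * y)) by ring.
    by rewrite wd; ring.
  rewrite !mulrA -mulrA ler_wpM2l// ?mulr_ge0// ?(ltW y0)//.
  rewrite ler_pdivrMr// mulrC ler_pdivlMr ?subr_gt0//.
  by rewrite (le_trans x1m)// lerDl mulr_ge0// ltW.
have dn := drift_decrease _ _ _ _ _ _ s0 sm y0 x10 x1x.
have := ler_wpM2l b0 (ler_wpM2l (ltW w0) dn).
have := ler_wpM2l b0 key.
have -> : w * (b * (drift m^-1 s y x1 - drift m^-1 s y x) + (x1 - x) +
   m * - (x1 - x)) = b * (w * (drift m^-1 s y x1 - drift m^-1 s y x)) +
   (1 - m) * (w * (x1 - x)) by ring.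
rewrite wd; lra.
Qed.

(* [2 / c i] is [0] where [c i = 0], and such coordinates do not move. *)
Lemma cover_step (R : realType) (n : nat) (b m : R) (c w x : 'I_n -> R) :
  0 < b -> 0 < m -> m <= 2^-1 -> (b * m + 1 + m) * (1 + m) <= b / (1 + m) ->
  (forall i, 0 <= c i) -> (exists i, c i != 0) -> (forall i, 0 < w i) ->
  (forall i, 0 <= x i) -> \sum_i c i * x i < 1 ->
  exists x1 : 'I_n -> R,
  [/\ forall i, 0 <= x1 i, forall i, x1 i <= Num.max (x i) (2 / c i),
      0 < \sum_i w i * `|x1 i - x i| &
      forall s y, 0 < s -> s <= m^-1 -> s * #|[pred i | c i != 0]|%:R <= m ->
        (forall i, 0 <= y i) -> 1 <= \sum_i c i * y i ->
        change b m s w y x x1 <= 0].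
Proof.
move=> b0 m0 m1 hb c0 [i0 ci0] w0 x0 cx1.
set d := #|[pred i | c i != 0]|; set k := m / d%:R.
have d0 : (0 < d%:R :> R).
  by rewrite ltr0n; apply/card_gt0P; exists i0; rewrite inE.
have k0 : 0 < k by rewrite divr_gt0.
have km : k <= m by rewrite ler_pdivrMr// ler_peMr ?(ltW m0)// ler1n -(@ltr0n R).
have cw0 i : 0 <= c i / w i by rewrite divr_ge0// ltW.
set S := 1 + \sum_i c i / w i.
have S0 : 0 < S by rewrite ltr_pwDl// sumr_ge0.
(* This step length keeps [tau * c i / w i <= m] in all coordinates at once. *)
set tau := m / S; have tau0 : 0 < tau by rewrite divr_gt0.
have taum i : tau * c i / w i <= m.
  rewrite /tau -mulrA mulrAC -mulrA ler_piMr ?(ltW m0)//.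
  rewrite ler_pdivrMr// mul1r /S (bigD1 i)//= addrCA lerDl addr_ge0//.
  exact: sumr_ge0.
set g := fun i => (c i * x i + k * (c i != 0)%:R).
have g0 i : 0 <= g i by rewrite addr_ge0// mulr_ge0// ltW.
pose x1 i := x i + tau * (if c i == 0 then 0 else c i * x i + k) / w i.
have gE i : (if c i == 0 then 0 else c i * x i + k) = g i.
  by rewrite /g; case: eqP => [->|_]; rewrite ?mul0r ?mulr0 ?addr0 ?mulr1.
(* The offsets [k = m / d] over the [d] support coordinates add up to [m], so the total rate stays
   below [1 + m]. *)
have sg : \sum_i g i = \sum_i c i * x i + m.
  rewrite big_split/= -mulr_sumr -natr_sum -big_mkcond/= sum1_card -/d.
  by rewrite /k divfK ?gt_eqF.
have cx0 : 0 <= \sum_i c i * x i by rewrite sumr_ge0// => i _; rewrite mulr_ge0.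
have cxle i : c i * x i <= 1.
  rewrite (le_trans _ (ltW cx1))// (bigD1 i)//= lerDl sumr_ge0// => j _.
  by rewrite mulr_ge0.
have dE i : x1 i - x i = tau * g i / w i by rewrite /x1 gE; ring.
have d_ge0 i : 0 <= x1 i - x i
  by rewrite dE divr_ge0 ?(ltW (w0 i))// mulr_ge0// ltW.
exists x1; split.
- by move=> i; rewrite -(subrK (x i) (x1 i)) addr_ge0.
- move=> i; rewrite le_max /x1; have [->|ci] := eqVneq (c i) 0.
    by rewrite mulr0 mul0r addr0 lexx.
  have cip : 0 < c i by rewrite lt_def ci c0.
  apply/orP; right; rewrite ler_pdivlMr// mulrDl.
  (* Violation gives [c i * x i <= 1], and one step adds at most [m * (1 + m) <= 3/4] to this
     product, whence the bound [2 / c i]. *)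
  have : tau * c i / w i * (c i * x i + k) <= m * (1 + m).
    rewrite ler_pM//; first by rewrite divr_ge0 ?(ltW (w0 i))// mulr_ge0// ltW.
    - by rewrite addr_ge0 ?mulr_ge0// ltW.
    - by rewrite lerD.
  rewrite /=.
  have -> : tau * (c i * x i + k) / w i * c i =
    tau * c i / w i * (c i * x i + k) by ring.
  have := cxle i; have := ler_pM (ltW m0) (ltW m0) m1 m1; lra.
- under eq_bigr do rewrite ger0_norm// dE mulrC divfK ?gt_eqF//.
  by rewrite -mulr_sumr sg mulr_gt0// ltr_wpDl.
- move=> s y s0 sm; rewrite -ler_pdivlMr// -/k => sk y0 cy1.
  have cy_ge0 i : 0 <= c i * y i by rewrite mulr_ge0.
  (* Truncating the terms at 1 preserves coverage: either one term reaches 1, or nothing is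
     truncated. *)
  have min1 : 1 <= \sum_i Num.min (c i * y i) 1.
    have [/existsP[i ci]|/existsPn h] := boolP [exists i, 1 <= c i * y i].
      rewrite (bigD1 i)//= min_r// lerDl sumr_ge0// => j _.
      by rewrite le_min cy_ge0 ler01.
    rewrite (le_trans cy1)// ler_sum// => i _; rewrite min_l// ltW// ltNge.
    exact: h.
  apply: (@le_trans _ _ (\sum_i tau * ((b * m + 1 + m) * g i -
      b * (Num.min (c i * y i) 1 / (1 + m))))).
    apply: ler_sum => i _; have [ci|ci] := eqVneq (c i) 0.
      rewrite /x1 /g ci eqxx !(mulr0, mul0r, addr0, subrr, normr0).
      by rewrite minEle ler01 !(mul0r, mulr0, subr0).
    rewrite -gE /x1 (negbTE ci); apply: (cover_coordinate _ _ _ _ k) => //.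
    + exact: ltW.
    + by rewrite lt_def ci c0.
    + exact: ltW.
  rewrite -mulr_sumr sumrB -!mulr_sumr -mulr_suml sg pmulr_rle0// subr_le0.
  have h1 : b / (1 + m) <= b * ((\sum_i Num.min (c i * y i) 1) / (1 + m)).
    by rewrite mulrA ler_pM2r ?invr_gt0 ?addr_gt0// ler_peMr// ltW.
  rewrite (le_trans _ h1)// (le_trans _ hb)// ler_wpM2l ?lerD2r ?(ltW cx1)//.
  by rewrite !addr_ge0// ?mulr_ge0// ltW.
Qed.

(** The linear term gains at rate above [(1 - m) * (1 + e)] by the violation, while the logarithms
    lose at rate at most [b / (1 - m)] because [y] satisfies the constraint. *)
Lemma pack_step (R : realType) (n : nat) (b m e : R) (p w x : 'I_n -> R) :
  0 < b -> 0 < m -> m < 1 -> b / (1 - m) <= (1 - m) * (1 + e) -> 0 <= e ->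
  (forall i, 0 <= p i) -> (forall i, 0 < w i) ->
  (forall i, 0 <= x i) -> 1 + e < \sum_i p i * x i ->
  exists x1 : 'I_n -> R,
  [/\ forall i, 0 <= x1 i, forall i, x1 i <= x i,
      0 < \sum_i w i * `|x1 i - x i| &
      forall s y, 0 < s -> s <= m^-1 ->
        (forall i, 0 <= y i) -> \sum_i p i * y i <= 1 ->
        change b m s w y x x1 <= 0].
Proof.
move=> b0 m0 m1 hb e0 p0 w0 x0 px1.
have pw0 i : 0 <= p i / w i by rewrite divr_ge0// ltW.
set S := 1 + \sum_i p i / w i.
have S0 : 0 < S by rewrite ltr_pwDl// sumr_ge0.
set tau := m / S; have tau0 : 0 < tau by rewrite divr_gt0.
have taum i : tau * p i / w i <= m.
  rewrite /tau -mulrA mulrAC -mulrA ler_piMr ?(ltW m0)//.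
  rewrite ler_pdivrMr// mul1r /S (bigD1 i)//= addrCA lerDl addr_ge0//.
  exact: sumr_ge0.
have v0 i : 0 <= tau * p i / w i.
  by rewrite divr_ge0 ?(ltW (w0 i))// mulr_ge0// ltW.
pose x1 i := x i - x i * (tau * p i / w i).
exists x1; split.
- move=> i; rewrite subr_ge0 ler_piMr// (le_trans (taum i))// ltW//.
- by move=> i; rewrite gerBl mulr_ge0.
- have E i : w i * `|x1 i - x i| = tau * (p i * x i).
    have v1 : 0 <= x i * (tau * p i / w i) by exact: mulr_ge0.
    rewrite /x1 addrAC subrr add0r normrN (ger0_norm v1).
    by field; rewrite gt_eqF.
  rewrite (eq_bigr _ (fun i _ => E i)).
  by rewrite -mulr_sumr mulr_gt0// (lt_trans _ px1)// ltr_pwDl.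
- move=> s y s0 sm y0 py1.
  apply: (@le_trans _ _ (\sum_i tau * (b * (p i * y i / (1 - m)) -
      (1 - m) * (p i * x i)))).
    apply: ler_sum => i _; apply: pack_coordinate => //; exact: ltW.
  rewrite -mulr_sumr sumrB -!mulr_sumr -mulr_suml pmulr_rle0// subr_le0.
  have h1 : b * ((\sum_i p i * y i) / (1 - m)) <= b / (1 - m).
    rewrite mulrA ler_pM2r ?invr_gt0 ?subr_gt0//.
    by rewrite -[leRHS]mulr1 ler_pM2l.
  rewrite (le_trans h1)// (le_trans hb)// ler_pM2l ?subr_gt0// ltW//.
Qed.

(** * Cheap displacements *)

(** Points are functions here, so that Tychonoff's theorem gives compact boxes. *)
Definition in_body {R : realType} {n : nat} (rho : R) (K : positive_body R n)
    (x : 'I_n -> R) : Prop :=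
  [/\ forall i, 0 <= x i, forall j, 1 <= \sum_i cover_mx K j i * x i
    & forall j, \sum_i pack_mx K j i * x i <= rho].

Lemma body_setE (R : realType) (n : nat) (rho : R) (K : positive_body R n)
  (x : 'cV[R]_n) : body_set rho K x <-> in_body rho K (fun i => x i 0).
Proof.
by split=> -[x0 cx px]; split=> // j;
  [have := cx j|have := px j|have := cx j|have := px j]; rewrite mxE.
Qed.

Definition admissible {R : realType} {n : nat} (m : R) (K : positive_body R n)
    (s : R) : Prop :=
  [/\ 0 < s, s <= m^-1 &
      forall j, s * #|[pred i | cover_mx K j i != 0]|%:R <= m].

Definition cheap {R : realType} {n : nat} (b m : R) (K : positive_body R n)
    (w x x1 : 'I_n -> R) : Prop :=
  forall s y, admissible m K s -> in_body 1 K y -> change b m s w y x x1 <= 0.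

(** The potential differences telescope; only the length term needs the triangle inequality. *)
Lemma change_trans (R : realType) (n : nat) (b m s : R)
    (w y x1 x2 x3 : 'I_n -> R) :
  0 <= m -> (forall i, 0 <= w i) ->
  change b m s w y x1 x3 <= change b m s w y x1 x2 + change b m s w y x2 x3.
Proof.
move=> m0 w0; rewrite /change -big_split ler_sum//= => i _.
rewrite -mulrDr ler_wpM2l//.
have := ler_wpM2l m0 (ler_distD (x2 i) (x3 i) (x1 i)); lra.
Qed.

Definition score {R : realType} {n : nat} (b m s : R) (w y x : 'I_n -> R) : R :=
  \sum_i w i * (b * drift m^-1 s (y i) (x i) + x i).

Lemma changeE (R : realType) (n : nat) (b m s : R) (w y x x1 : 'I_n -> R) :
  change b m s w y x x1 =
  score b m s w y x1 - score b m s w y x + m * \sum_i w i * `|x1 i - x i|.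
Proof.
rewrite /change /score mulr_sumr -sumrB -big_split.
by apply: eq_bigr => i _ /=; ring.
Qed.

Lemma changeDl (R : realType) (n : nat) (b m s h : R) (w y x x1 : 'I_n -> R) :
  change b m s (fun i => w i + h) y x x1 =
  change b m s w y x x1 + h * change b m s (fun=> 1) y x x1.
Proof.
rewrite /change mulr_sumr -big_split; apply: eq_bigr => i _ /=; ring.
Qed.

(** * Existence of cheap feasible points by compactness *)

Section ProductTopology.
Context {R : realType} {n : nat}.
Let T := prod_topology (fun _ : 'I_n => R).

Lemma continuous_sum (F : 'I_n -> T -> R) :
  (forall i, continuous (F i)) -> continuous (fun x => \sum_i F i x).
Proof. by move=> Fc; apply: continuous_big => //; exact: add_continuous. Qed.

Lemma coordinate_continuous (g : R -> R) i :
  continuous g -> continuous (fun x : T => g (x i)).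
Proof.
move=> gc x; apply: (@continuous_comp _ _ _ (fun x : T => x i) g); last exact: gc.
exact: (@proj_continuous _ (fun _ : 'I_n => R) i).
Qed.

Lemma change_continuous (b m s : R) (w y x : 'I_n -> R) :
  0 < s -> s <= m^-1 -> (forall i, 0 <= y i) ->
  continuous (change b m s w y x : T -> R).
Proof.
move=> s0 sm y0; apply: continuous_sum => i.
apply: (coordinate_continuous (fun z => w i *
  (b * (drift m^-1 s (y i) z - drift m^-1 s (y i) (x i)) + (z - x i) +
   m * `|z - x i|))) => z.
apply: cvgM; first exact: cvg_cst.
have zx : u - x i @[u --> z] --> z - x i by apply: cvgB => //; exact: cvg_cst.
apply: cvgD; last by apply: cvgM; [exact: cvg_cst|exact: cvg_norm].
apply: cvgD => //; apply: cvgM; first exact: cvg_cst.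
by apply: cvgB; [exact: drift_continuous|exact: cvg_cst].
Qed.

Lemma score_continuous (b m s : R) (w y : 'I_n -> R) :
  0 < s -> s <= m^-1 -> (forall i, 0 <= y i) ->
  continuous (score b m s w y : T -> R).
Proof.
move=> s0 sm y0; apply: continuous_sum => i.
apply: (coordinate_continuous (fun z => w i *
  (b * drift m^-1 s (y i) z + z))) => z.
apply: cvgM; first exact: cvg_cst.
apply: cvgD => //; apply: cvgM; first exact: cvg_cst.
exact: drift_continuous.
Qed.

Lemma closed_sublevel (f : T -> R) r : continuous f -> closed [set x | f x <= r].
Proof.
by move=> /continuous_closedP fc; exact: (fc [set z | z <= r] (@closed_le _ r)).
Qed.

Lemma closed_superlevel (f : T -> R) r : continuous f -> closed [set x | r <= f x].
Proof.
by move=> /continuous_closedP fc; exact: (fc [set z | r <= z] (@closed_ge _ r)).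
Qed.

Lemma box_compact (B : 'I_n -> R) :
  compact ([set x | forall i, `[0, B i]%classic (x i)] : set T).
Proof.
exact: (@tychonoff _ (fun _ : 'I_n => R) (fun i => `[0, B i]%classic)
  (fun i => @segment_compact R 0 (B i))).
Qed.

Lemma in_body_closed (rho : R) (K : positive_body R n) :
  closed (in_body rho K : set T).
Proof.
have rowc r (C : 'M[R]_(r, n)) j : continuous (fun x : T => \sum_i C j i * x i).
  apply: continuous_sum => i; apply: (coordinate_continuous (fun z => C j i * z)).
  exact: mulrl_continuous.
have -> : in_body rho K = (\bigcap_i [set x : T | 0 <= x i]) `&`
    ((\bigcap_j [set x : T | 1 <= \sum_i cover_mx K j i * x i]) `&`
    \bigcap_j [set x : T | \sum_i pack_mx K j i * x i <= rho]).
  apply/seteqP; split.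
    move=> x [x0 cx px]; split; first by move=> i _; exact: x0.
    by split=> j _; [exact: cx|exact: px].
  move=> x [x0 [cx px]].
  by split=> i; [exact: (x0 i)|exact: (cx i)|exact: (px i)].
apply: closedI; [|apply: closedI]; apply: closed_bigI => j _.
- apply: closed_superlevel; apply: (coordinate_continuous id) => z.
  exact: cvg_id.
- by apply: closed_superlevel; exact: rowc.
- by apply: closed_sublevel; exact: rowc.
Qed.

Lemma cheap_closed (b m : R) (K : positive_body R n) (w x : 'I_n -> R) :
  closed (cheap b m K w x : set T).
Proof.
have -> : cheap b m K w x = \bigcap_(p in [set p | admissible m K p.1 /\
    in_body 1 K p.2]) [set x1 : T | change b m p.1 w p.2 x x1 <= 0].
  apply/seteqP; split=> [x1 h [s y] [/= sm yK]|x1 h s y sm yK]; first exact: h.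
  exact: (h (s, y)).
apply: closed_bigI => -[s y] [/= [s0 sm _] [y0 _ _]].
by apply: closed_sublevel; exact: change_continuous.
Qed.

(** The coordinate bound does not involve [w], so one compact box serves all the perturbed weights
    in [exists_cheap]. *)
Lemma exists_cheap_pos (b m e : R) (K : positive_body R n) (w x y0 : 'I_n -> R) :
  0 < b -> 0 < m -> m <= 2^-1 -> (b * m + 1 + m) * (1 + m) <= b / (1 + m) ->
  b / (1 - m) <= (1 - m) * (1 + e) -> 0 <= e ->
  (forall i, 0 < w i) -> in_body 1 K y0 -> (forall i, 0 <= x i) ->
  exists x1, [/\ in_body (1 + e) K x1, cheap b m K w x x1 &
    forall i, x1 i <= x i + \sum_j 2 / cover_mx K j i].
Proof.
move=> b0 m0 m1 hb hp e0 w0 y0K x0.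
set B := fun i => x i + \sum_j 2 / cover_mx K j i.
have inv0 j i : 0 <= 2 / cover_mx K j i by rewrite divr_ge0// cover_mx_ge0.
have xB i : x i <= B i by rewrite lerDl sumr_ge0.
have jB j i : 2 / cover_mx K j i <= B i.
  by rewrite /B (bigD1 j)//= addrCA lerDl addr_ge0// sumr_ge0.
have m1' : m < 1 by lra.
have w0' i : 0 <= w i by exact: ltW.
(* A row has at most [n] nonzero entries; [n.+1] also covers [n = 0]. *)
have [s0 s0m] : exists s, admissible m K s.
  exists (m / n.+1%:R); split; first by rewrite divr_gt0.
    apply: (@le_trans _ _ 1); last by rewrite invf_ge1// ltW.
    by rewrite ler_pdivrMr// mul1r (le_trans (ltW m1'))// ler1n.
  move=> j; rewrite mulrAC ler_pdivrMr// ler_pM2l// ler_nat.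
  by rewrite (leq_trans (max_card _))// card_ord.
have [s00 s0L _] := s0m; have [y00 cy0 _] := y0K.
pose S : set T := [set x1 : T | forall i, `[0, B i]%classic (x1 i)] `&`
  cheap b m K w x.
have Scompact : compact S.
  by apply: compact_closedI; [exact: box_compact|exact: cheap_closed].
have Sx : S x.
  split=> [i|s y _ _]; first by rewrite /= in_itv/= x0 xB.
  by rewrite /change big1// => i _; rewrite !subrr normr0; ring.
have [|/= x1 /set_mem[x1B x1cheap] x1min] :=
    compact_EVT_min (f := score b m s0 w y0 : T -> R) (ex_intro _ x Sx) Scompact.
  by apply: continuous_subspaceT; exact: score_continuous.
have x10 i : 0 <= x1 i by have := x1B i; rewrite /= in_itv/= => /andP[].
have x1le i : x1 i <= B i by have := x1B i; rewrite /= in_itv/= => /andP[].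
(* By transitivity a further cheap step stays in [S], and positive length would lower the minimal
   score. *)
have stuck x2 : (forall i, 0 <= x2 i) -> (forall i, x2 i <= B i) ->
    0 < \sum_i w i * `|x2 i - x1 i| -> cheap b m K w x1 x2 -> False.
  move=> x20 x2B moves x2cheap.
  have /x1min : x2 \in S.
    apply/mem_set; split=> [i|s y sm yK]; first by rewrite /= in_itv/= x20 x2B.
    apply: le_trans (change_trans _ _ _ _ _ _ _ _ x1 _ (ltW m0) w0') _.
    by have := x1cheap s y sm yK; have := x2cheap s y sm yK; lra.
  have := changeE _ _ b m s0 w y0 x1 x2; have := x2cheap s0 y0 s0m y0K.
  have := mulr_gt0 m0 moves; lra.
exists x1; split=> //; split=> // j; rewrite leNgt; apply/negP => viol.
  have [|x2 [x20 x2B moves x2c]] :=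
      cover_step _ _ _ _ _ _ _ b0 m0 m1 hb (@cover_mx_ge0 _ _ K j) _ w0 x10 viol.
    (* A zero row could not be covered by [y0]. *)
    apply: contrapT => /forallNP c0; have := cy0 j.
    rewrite big1 ?ler10// => i _.
    by have /negP := c0 i; rewrite negbK => /eqP ->; rewrite mul0r.
  apply: (stuck x2) => // [i|s y [s1 sL sd] [y1 cy _]]; last exact: x2c.
  by rewrite (le_trans (x2B i))// ge_max x1le jB.
have [x2 [x20 x2B moves x2c]] :=
    pack_step _ _ _ _ _ _ _ _ b0 m0 m1' hp e0 (@pack_mx_ge0 _ _ K j) w0 x10 viol.
apply: (stuck x2) => // [i|s y [s1 sL sd] [y1 _ py]]; last exact: x2c.
by rewrite (le_trans (x2B i)).
Qed.

Lemma exists_cheap (b m e : R) (K : positive_body R n) (w x y0 : 'I_n -> R) :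
  0 < b -> 0 < m -> m <= 2^-1 -> (b * m + 1 + m) * (1 + m) <= b / (1 + m) ->
  b / (1 - m) <= (1 - m) * (1 + e) -> 0 <= e ->
  (forall i, 0 <= w i) -> in_body 1 K y0 -> (forall i, 0 <= x i) ->
  exists x1, in_body (1 + e) K x1 /\ cheap b m K w x x1.
Proof.
move=> b0 m0 m1 hb hp e0 w0 y0K x0.
have wk0 (k : nat) i : 0 < w i + k.+1%:R^-1 by rewrite ltr_wpDl// invr_gt0.
have /choice[f fP] := fun k => exists_cheap_pos b m e K _ x y0
  b0 m0 m1 hb hp e0 (wk0 k) y0K x0.
pose A : set T := [set x1 : T | forall i,
   `[0, x i + \sum_j 2 / cover_mx K j i]%classic (x1 i)] `&` in_body (1 + e) K.
have Acompact : compact A.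
  by apply: compact_closedI; [exact: box_compact|exact: in_body_closed].
have fA : ((f : nat -> T) @ \oo) A.
  exists 0%N => // k _; have [fK _ fB] := fP k; split=> // i.
  by rewrite /= in_itv/= fB andbT; case: fK.
have [x1 [[_ x1K] x1cl]] := Acompact _ _ fA.
exists x1; split=> // s y sm yK; rewrite leNgt; apply/negP => pos.
have [[s0 sL _] [y1 _ _]] := (sm, yK).
pose g : T -> R := change b m s w y x.
pose h : T -> R := change b m s (fun=> 1) y x.
have gc := change_continuous b m s w y x s0 sL y1.
have hc := change_continuous b m s (fun=> 1) y x s0 sL y1.
(* Cheapness of [f k] reads [g (f k) + h (f k) / (k + 1) <= 0]. Near the cluster point [x1], [g]
   stays above [g x1 / 2 > 0] and [h] is bounded below, which is impossible for large [k]. *)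
have gN : \forall z \near x1, g x1 / 2 < g z.
  by apply: (cvgr_gt (g x1) (gc x1)); rewrite /g; lra.
have hN : \forall z \near x1, h x1 - 1 < h z.
  by apply: (cvgr_gt (h x1) (hc x1)); lra.
set N := Num.bound ((`|h x1| + 1) / (g x1 / 2)).
have fN : ((f : nat -> T) @ \oo) (f @` [set k | (N <= k)%N]).
  by exists N => // k Nk; exists k.
have [z [[k Nk <-] [gz hz]]] := x1cl _ _ fN (filterI gN hN).
have [_ /(_ s y sm yK) + _] := fP k; rewrite changeDl -/(g (f k)) -/(h (f k)).
have g2 : 0 < g x1 / 2 by rewrite divr_gt0.
have : (`|h x1| + 1) / (g x1 / 2) < k.+1%:R.
  apply: lt_le_trans (archi_boundP _) _; first by rewrite divr_ge0 ?addr_ge0// ltW.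
  by rewrite ler_nat (leq_trans Nk).
rewrite ltr_pdivrMr// => hk.
have k0 : 0 < k.+1%:R :> R by [].
rewrite -(pmulr_rle0 _ k0) mulrDr mulVKf ?gt_eqF//.
have := ltr_pM2l k0 (g x1 / 2) (g (f k)); rewrite gz.
have := ler_norm (- h x1); rewrite normrN.
lra.
Qed.
End ProductTopology.

(** * Summation over time *)

Lemma score_lipschitz (R : realType) (n : nat) (b m s : R)
    (w x y y1 : 'I_n -> R) :
  0 <= b -> 0 < s -> s <= m^-1 -> (forall i, 0 <= w i) ->
  (forall i, 0 <= y i) -> (forall i, 0 <= y1 i) ->
  score b m s w y1 x - score b m s w y x
  <= b * (ln (m^-1 / s) + 1) * \sum_i w i * `|y1 i - y i|.
Proof.
move=> b0 s0 sm w0 y0 y10; rewrite /score -sumrB mulr_sumr ler_sum// => i _.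
have := drift_lipschitz _ _ _ _ _ (x i) s0 sm (y10 i) (y0 i).
move=> /(ler_wpM2l b0)/(ler_wpM2l (w0 i)); lra.
Qed.

Lemma movementS (R : realType) (n : nat) (w : 'cV[R]_n) (T : nat)
    (x : nat -> 'cV[R]_n) :
  movement w T.+1 x =
  movement w T x + \sum_i w i 0 * `|x T.+1 i 0 - x T i 0|.
Proof. by rewrite /movement big_nat_recr. Qed.

Lemma score_ge0 (R : realType) (n : nat) (b m s : R) (w y x : 'I_n -> R) :
  0 <= b -> 0 < s -> s <= m^-1 -> (forall i, 0 <= w i) ->
  (forall i, 0 <= y i) -> (forall i, 0 <= x i) -> 0 <= score b m s w y x.
Proof.
move=> b0 s0 sm w0 y0 x0; apply: sumr_ge0 => i _.
by rewrite mulr_ge0// addr_ge0// mulr_ge0// drift_ge0.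
Qed.

Lemma movement_le (R : realType) (n : nat) (b m s : R) (w : 'cV[R]_n)
    (K : nat -> positive_body R n) (T : nat) (x y : nat -> 'cV[R]_n) :
  0 <= b -> 0 < m -> (forall i, 0 <= w i 0) -> 0 < s -> s <= m^-1 ->
  x 0%N = 0 -> offline_solution K T y ->
  (forall t i, (t <= T)%N -> 0 <= x t i 0) ->
  (forall t, (1 <= t <= T)%N -> admissible m (K t) s) ->
  (forall t, (t < T)%N -> cheap b m (K t.+1) (fun i => w i 0)
     (fun i => x t i 0) (fun i => x t.+1 i 0)) ->
  m * movement w T x <= b * (ln (m^-1 / s) + 1) * movement w T y.
Proof.
move=> b0 m0 w0 s0 sm x00 [y00 yK] x0 adm xc.
pose sc t := score b m s (fun i => w i 0) (fun i => y t i 0) (fun i => x t i 0).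
have y0 t i : (t <= T)%N -> 0 <= y t i 0.
  case: t => [|t] tT; first by rewrite y00 mxE.
  by have [] := yK t.+1 tT.
(* Amortization: the score vanishes at time 0, where both points are 0, and is nonnegative at time
   [T]. *)
suff main t : (t <= T)%N ->
    m * movement w t x + sc t <= b * (ln (m^-1 / s) + 1) * movement w t y.
  apply: le_trans (main T (leqnn T)); rewrite lerDl score_ge0// => i.
  - exact: y0.
  - exact: x0.
elim: t => [_|t IH tT].
  rewrite /movement !big_geq// !mulr0 add0r /sc /score big1// => i _.
  by rewrite x00 y00 /drift !mxE mul0r; ring.
(* First [y] moves while [x t] is fixed, then [x] moves against the new [y]. *)
have := IH (ltnW tT); rewrite !movementS.
have := xc t tT s (fun i => y t.+1 i 0) (adm t.+1 tT).
rewrite -body_setE => /(_ (yK t.+1 tT)); rewrite changeE.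
have := score_lipschitz _ _ b m s (fun i => w i 0) (fun i => x t i 0)
  (fun i => y t i 0) (fun i => y t.+1 i 0) b0 s0 sm w0
  (fun i => y0 t i (ltnW tT)) (fun i => y0 t.+1 i tT).
rewrite -/(sc t.+1) -/(sc t); lra.
Qed.

(** * Choice of the shift and of the constants *)

Lemma ln_le_sub1 (R : realType) (x : R) : 0 < x -> ln x <= x - 1.
Proof. by move=> x0; have := ler_lnB _ _ _ x0 ltr01; rewrite ln1 subr0 divr1. Qed.

Lemma row_sparsity_le (R : realType) (n : nat) (K : nat -> positive_body R n)
    (T t : nat) (j : 'I_(cover_rows (K t))) :
  (1 <= t <= T)%N ->
  (#|[pred i | cover_mx (K t) j i != 0%R]| <= cover_sparsity K T)%N.
Proof.
move=> tT; rewrite /cover_sparsity.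
apply: leq_trans (@leq_bigmax _
  (fun i => #|[pred k | cover_mx (K t) i k != 0%R]|) j) _.
apply: (@leq_bigmax_seq _ (index_iota 1 T.+1) xpredT (fun t =>
  \max_(i < cover_rows (K t)) #|[pred k | cover_mx (K t) i k != 0%R]|)) => //.
by rewrite mem_index_iota.
Qed.

(** A single shift must serve all times up to [T]. With [m = eps / 16], [s = m / D] and
    [r = D / eps], one has [1 / (m s) <= 2^8 r^2], and [8 ln 2 + 2 ln r + 1 <= 9 (1 + ln r)]. *)
Lemma exists_shift (R : realType) (n : nat) (eps : R)
    (K : nat -> positive_body R n) (T : nat) :
  0 < eps -> eps <= 1 ->
  exists s, [/\ 0 < s, s <= (eps / 16)^-1,
    forall t, (1 <= t <= T)%N -> admissible (eps / 16) (K t) s &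
    ln ((eps / 16)^-1 / s) + 1
      <= 9 * (1 + ln ((cover_sparsity K T)%:R / eps))].
Proof.
move=> e0 e1; have m0 : 0 < eps / 16 by rewrite divr_gt0.
have [D0|D0] := posnP (cover_sparsity K T).
  (* Here [ln (0 / eps)] is the junk value [0], and [s = 1/m] makes [ln (1/(m s))]
     vanish as well. *)
  exists (eps / 16)^-1; rewrite D0 mul0r (ln0 (lexx 0)).
  rewrite divff ?ln1 ?invr_eq0 ?gt_eqF//.
  split; rewrite ?invr_gt0//; last by lra.
  move=> t tT; split; rewrite ?invr_gt0// => j.
  have := row_sparsity_le _ _ _ _ _ j tT; rewrite D0 leqn0 => /eqP ->.
  by rewrite mulr0 ltW.
set D := cover_sparsity K T in D0 *.
have Dp : 0 < D%:R :> R by rewrite ltr0n.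
have D1 : 1 <= D%:R :> R by rewrite ler1n.
have sm : eps / 16 / D%:R <= (eps / 16)^-1.
  apply: (@le_trans _ _ 1); last by rewrite invf_ge1//; lra.
  by rewrite ler_pdivrMr// mul1r; lra.
exists (eps / 16 / D%:R); split=> //; first by rewrite divr_gt0.
  move=> t tT; split=> //; first by rewrite divr_gt0.
  move=> j; rewrite mulrAC ler_pdivrMr// ler_pM2l// ler_nat.
  exact: row_sparsity_le.
set r := D%:R / eps; have r1 : 1 <= r by rewrite ler_pdivlMr// mul1r; lra.
have r0 : 0 < r by exact: lt_le_trans r1.
have lnr : 0 <= ln r by exact: ln_ge0.
have h : ln ((eps / 16)^-1 / (eps / 16 / D%:R)) <= ln (2 ^+ 8 * (r * r)).
  rewrite ler_ln ?posrE ?mulr_gt0 ?invr_gt0 ?divr_gt0//.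
  have -> : (eps / 16)^-1 / (eps / 16 / D%:R) = 2 ^+ 8 * (r * eps^-1).
    by rewrite /r; field; rewrite gt_eqF// gt_eqF.
  rewrite !ler_pM2l// /r ler_peMl// invr_ge0 ltW//.
have ln2 : ln 2 <= 1 :> R by apply: le_trans (ln_le_sub1 _ _ _) _ => //; lra.
have rr : ln (r * r) = ln r + ln r by rewrite lnM ?posrE.
have lnE : ln (2 ^+ 8 * (r * r)) = ln (2 ^+ 8) + ln (r * r).
  by apply: lnM; rewrite posrE ?exprn_gt0// mulr_gt0.
move: h; rewrite lnE rr lnXn// -mulr_natr; lra.
Qed.

Lemma cheap_nonneg_exists (R : realType) (n : nat) (eps : R) (w x : 'cV[R]_n)
    (K : positive_body R n) :
  0 < eps -> eps <= 1 -> (forall i, 0 <= w i 0) -> (forall i, 0 <= x i 0) ->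
  body_set 1 K !=set0 ->
  exists x1, body_set (1 + eps) K x1 /\
    cheap (1 + eps / 2) (eps / 16) K (fun i => w i 0) (fun i => x i 0)
      (fun i => x1 i 0).
Proof.
move=> e0 e1 w0 x0 [y /body_setE yK].
have m0 : 0 < eps / 16 by rewrite divr_gt0.
have ee : eps * eps <= eps by rewrite ler_piMr// ltW.
have eee : eps * eps * eps <= eps * eps by rewrite ler_piMr// mulr_ge0// ltW.
have eee0 : 0 <= eps * eps * eps by rewrite !mulr_ge0// ltW.
have [||||x1 [x1K x1c]] := exists_cheap (1 + eps / 2) (eps / 16) eps K
    (fun i => w i 0) (fun i => x i 0) _ _ m0 _ _ _ (ltW e0) w0 yK x0.
- lra.
- lra.
(* To first order in [eps], the covering inequality compares [4 m = eps / 4] with [eps / 2], and the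
   packing one [eps / 2] with [eps - 2 m = 7 eps / 8]. *)
- rewrite ler_pdivlMr; last by lra.
  have := ler_wpM2l (ltW e0) eee; lra.
- rewrite ler_pdivrMr; last by lra.
  lra.
exists (\col_i x1 i); rewrite body_setE.
by have -> : (fun i => (\col_i x1 i) i 0) = x1 by apply/funext => i; rewrite mxE.
Qed.

(* The ratio is written (1/eps) (1 + ln (d/eps)): the usual reading of
   O((1/eps) log (d/eps)), which would otherwise vanish at d = eps = 1. *)
Theorem theorem1p1 (R : realType) :
  exists2 c : R, 0 < c &
  forall (eps : R) (n : nat) (w : 'cV[R]_n),
    0 < eps -> eps <= 1 -> (forall i, 0 <= w i 0) ->
  exists A : online_algorithm R n,
  forall (K : nat -> positive_body R n) (T : nat),
    (forall t, (1 <= t <= T)%N -> body_set 1 (K t) !=set0) ->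
    (forall t, (1 <= t <= T)%N ->
       body_set (1 + eps) (K t) (trajectory A K t)) /\
    movement w T (trajectory A K)
      <= c * (eps^-1 * (1 + ln ((cover_sparsity K T)%:R / eps)))
           * offline_opt w K T.
Proof.
(* [216 = 16 * (3 / 2) * 9]: from [1 / m = 16 / eps], from [b <= 3 / 2] and from [exists_shift]. *)
exists 216 => // eps n w e0 e1 w0.
have m0 : 0 < eps / 16 by rewrite divr_gt0.
have b0 : 0 <= 1 + eps / 2 by lra.
(* The hypotheses are part of the relation, so that [step] is total, even on empty bodies. *)
pose good (p : 'cV[R]_n * positive_body R n) x1 :=
  (forall i, 0 <= p.1 i 0) -> body_set 1 p.2 !=set0 ->
  body_set (1 + eps) p.2 x1 /\
  cheap (1 + eps / 2) (eps / 16) p.2 (fun i => w i 0) (fun i => p.1 i 0)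
    (fun i => x1 i 0).
have [|step stepP] := @choice _ _ good.
  move=> [x K]; have [[x0 K0]|h] := pselect ((forall i, 0 <= x i 0) /\
      body_set 1 K !=set0).
    by have [x1 x1P] := cheap_nonneg_exists _ _ _ _ _ _ e0 e1 w0 x0 K0; exists x1.
  by exists 0 => x0 K0; case: h.
exists (foldl (fun x K => step (x, K)) 0) => K T Kne.
set x := trajectory _ K.
have xS t : x t.+1 = step (x t, K t.+1).
  have xE u : x u = foldl (fun x K => step (x, K)) 0 [seq K v | v <- iota 1 u].
    by case: u.
  by rewrite !xE -(addn1 t) iotaD map_cat foldl_cat add1n addn1.
have xgood t : good (x t, K t.+1) (x t.+1) by rewrite xS; exact: stepP.
have x0 t : (t <= T)%N -> forall i, 0 <= x t i 0.
  elim: t => [|t IH] tT; first by move=> i; rewrite mxE.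
  by have [[]] := xgood t (IH (ltnW tT)) (Kne t.+1 tT).
have xK t : (1 <= t <= T)%N -> body_set (1 + eps) (K t) (x t).
  by case: t => // t tT; have [] := xgood t (x0 t (ltnW tT)) (Kne t.+1 tT).
split=> //.
have [s [s0 sm adm lns]] := exists_shift _ _ eps K T e0 e1.
set r := ln (_%:R / _) in lns *.
(* [9 * (1 + r)] dominates [ln ((eps / 16)^-1 / s) + 1 >= 1]. *)
have r0 : 0 < 1 + r.
  have := ln_ge0 (x := (eps / 16)^-1 / s); rewrite ler_pdivlMr// mul1r => /(_ sm).
  lra.
have c0 : 0 < 216 * (eps^-1 * (1 + r)) by rewrite !mulr_gt0// invr_gt0.
rewrite mulrC -ler_pdivrMr//; apply: lb_le_inf.
  (* To bound the infimum from below, some offline solution must exist: pick a point in each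
     body. *)
  have /choice[y yP] t : exists v, (1 <= t <= T)%N -> body_set 1 (K t) v.
    have [/Kne[v vK]|_] := boolP (1 <= t <= T)%N; first by exists v.
    by exists 0.
  exists (movement w T (fun t => if t is 0%N then 0 else y t)).
  exists (fun t => if t is 0%N then 0 else y t) => //; split=> // -[|t]//.
  exact: yP.
move=> _ [y yK <-]; rewrite ler_pdivrMr// mulrC.
have := movement_le _ _ (1 + eps / 2) (eps / 16) s w K T x y b0 m0 w0 s0 sm
  erefl yK _ adm _.
have y0 : 0 <= movement w T y.
  apply: sumr_ge0 => t _; apply: sumr_ge0 => i _; exact: mulr_ge0.
have -> : 216 * (eps^-1 * (1 + r)) * movement w T y =
    (216 * (1 + r) * movement w T y) / eps by ring.
rewrite ler_pdivlMr// => main.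
have {main} h : eps / 16 * movement w T x <=
    (1 + eps / 2) * (ln ((eps / 16)^-1 / s) + 1) * movement w T y.
  apply: main => [t i tT|t tT]; first exact: x0.
  by have [] := xgood t (x0 t (ltnW tT)) (Kne t.+1 tT).
have h2 : (1 + eps / 2) * (ln ((eps / 16)^-1 / s) + 1) <= 3 / 2 * (9 * (1 + r)).
  apply: (@le_trans _ _ ((1 + eps / 2) * (9 * (1 + r)))).
    by rewrite ler_wpM2l.
  by rewrite ler_wpM2r ?mulr_ge0 ?(ltW r0)//; lra.
have := ler_wpM2r y0 h2; lra.
Qed.
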